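(* Let $\mathcal L=\mathbb N\times\mathbb N\times(\mathbb N\cup\{\infty\})$ be equipped with the order given by $(i_1,j_1,k_1)\le(i_2,j_2,k_2)$ if and only if either (1) $i_1=i_2$, $j_1=j_2$ and $k_1\le k_2\le\infty$; or (2) $i_2=i_1+1$, $k_1\le j_2$ and $k_2=\infty$. Let $(\Sigma\mathcal L)_\top$ be the space obtained from the Scott space $\Sigma\mathcal L$ by adjoining a top point $\top$. Then $(\Sigma\mathcal L)_\top$ is a sober space whose Scott power space $\Sigma\,\mathsf{K}((\Sigma\mathcal L)_\top)$ is non-sober.
   Context: $\mathbb N=\{1,2,3,\dots\}$ with its usual order. For a poset $P$, a subset $U$ is Scott open if $U$ is an upper set and for every (nonempty) directed $D\subseteq P$ whose supremum $\bigvee D$ exists in $P$, $\bigvee D\in U$ implies $D\cap U\neq\emptyset$; these sets form the Scott topology $\sigma(P)$, and $\Sigma P=(P,\sigma(P))$. For an irreducible $T_0$ space $X$ (i.e. $X$ is nonempty and not the union of two proper closed subsets) and a point $\top\notin X$, $X_\top$ denotes the set $X\cup\{\top\}$ with the topology whose closed sets are exactly the closed sets $C\ne X$ of $X$ together with $X\cup\{\top\}$. The space $\Sigma\mathcal L$ is irreducible, so $(\Sigma\mathcal L)_\top$ is defined. A subset of a $T_0$ space $X$ is saturated if it equals the intersection of all open sets containing it. $\mathsf{K}(X)$ denotes the set of all nonempty compact saturated subsets of $X$, ordered by the Smyth order $K_1\sqsubseteq K_2 \iff K_2\subseteq K_1$, and the Scott power space of $X$ is $\Sigma\,\mathsf{K}(X)=(\mathsf{K}(X),\sigma(\mathsf{K}(X)))$.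 A space is sober if every irreducible closed subset is the closure of a unique point. *)

(* Defs.v *)
From HB Require Import structures.
From mathcomp Require Import all_boot all_order.
From mathcomp Require Import boolp classical_sets functions filter.
From mathcomp Require Import topology_structure compact.
Set Implicit Arguments.
Unset Strict Implicit.
Unset Printing Implicit Defensive.
Import Order.TTheory.
Local Open Scope classical_set_scope.

(* A proper subset of [A] that is closed in the closed set [A] is the same
   thing as a closed set of [X] properly contained in [A]. *)
Definition irreducible_closed (X : topologicalType) (A : set X) : Prop :=
  [/\ closed A, A !=set0 &
    ~ exists C1 C2 : set X,
        [/\ closed C1, closed C2, C1 `<` A, C2 `<` A & A = C1 `|` C2]].

Definition irreducible_space (X : topologicalType) : Prop :=
  irreducible_closed [set: X].

Definition sober (X : topologicalType) : Prop :=
  forall A : set X, irreducible_closed A -> exists! x : X, A = closure [set x].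

Definition saturated (X : topologicalType) (A : set X) : Prop :=
  A = \bigcap_(U in [set U : set X | open U /\ A `<=` U]) U.

Section Scott.
Context (d : Order.disp_t) (P : porderType d).

Definition directed (D : set P) : Prop :=
  D !=set0 /\
  forall x y, D x -> D y -> exists z, [/\ D z, (x <= z)%O & (y <= z)%O].

Definition upper_set (U : set P) : Prop :=
  forall x y, U x -> (x <= y)%O -> U y.

(* [supremums D] is the set of least upper bounds of [D]; it has at most one
   element and is empty when [D] has no supremum. *)
Definition scott_open (U : set P) : Prop :=
  upper_set U /\
  forall (D : set P) (s : P),
    directed D -> supremums D s -> U s -> (D `&` U) !=set0.

Lemma scott_openT : scott_open setT.
Proof. by split=> // D s [[x Dx] _] _ _; exists x. Qed.

Lemma scott_openI : setI_closed scott_open.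
Proof.
move=> U V [uU sU] [uV sV]; split=> [x y [Ux Vx] xy|D s dD Ds [Us Vs]].
  by split; [exact: uU xy|exact: uV xy].
have [x [Dx Ux]] := sU D s dD Ds Us.
have [y [Dy Vy]] := sV D s dD Ds Vs.
have [z [Dz xz yz]] := dD.2 x y Dx Dy.
by exists z; split=> //; split; [exact: uU xz|exact: uV yz].
Qed.

Lemma scott_open_bigU (J : Type) (f : J -> set P) :
  (forall i, scott_open (f i)) -> scott_open (\bigcup_i f i).
Proof.
move=> fo; split=> [x y [i _ fx] xy|D s dD Ds [i _ fs]].
  by exists i => //; exact: (fo i).1 xy.
have [x [Dx fx]] := (fo i).2 D s dD Ds fs.
by exists x; split=> //; exists i.
Qed.

(* The Scott space of [P]: the carrier is [P] itself, under another name so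
   that the Scott topology is not attached to [P] globally. *)
Definition scott : Type := P.

HB.instance Definition _ := Choice.on scott.
HB.instance Definition _ :=
  isOpenTopological.Build scott scott_openT scott_openI scott_open_bigU.

Lemma scott_openE (U : set scott) : open U = scott_open U.
Proof. by []. Qed.

End Scott.

Section AddTop.
Context (X : topologicalType) (irrX : irreducible_space X).

(* The new point is [None]. *)
Definition add_top_closed (C : set (option X)) : Prop :=
  C = setT \/ exists C0 : set X, [/\ closed C0, C0 <> setT & C = Some @` C0].

Definition add_top_open (U : set (option X)) : Prop := add_top_closed (~` U).

Lemma add_top_openT : add_top_open setT.
Proof.
right; exists set0; split; rewrite ?setCT ?image_set0//; first exact: closed0.
by have [_ [x _] _] := irrX => e; have : @setT X x by []; rewrite -e.
Qed.

Lemma add_top_openI : setI_closed add_top_open.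
Proof.
move=> U V; rewrite /add_top_open setCI.
move=> [->|[C [cC nC ->]]]; first by rewrite setTU; left.
move=> [->|[D [cD nD ->]]]; first by rewrite setUT; left.
right; exists (C `|` D); split; [exact: closedU| |by rewrite image_setU].
move=> e; have [_ _] := irrX; apply; exists C, D; split=> //.
- by split=> // TC; apply: nC; apply/seteqP; split.
- by split=> // TD; apply: nD; apply/seteqP; split.
Qed.

Lemma add_top_open_bigU (J : Type) (f : J -> set (option X)) :
  (forall i, add_top_open (f i)) -> add_top_open (\bigcup_i f i).
Proof.
move=> fo; rewrite /add_top_open setC_bigcup.
have [[i fi]|all1] := pselect (exists i, ~` f i <> setT); last first.
  left; apply/seteqP; split=> // x _ i _.
  by have -> : ~` f i = setT by apply: contrapT => h; apply: all1; exists i.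
have [//|[C [cC nC fC]]] := fo i.
right; exists (\bigcap_j (Some @^-1` (~` f j))); split.
- apply: closed_bigI => j _.
  have [->|[D [cD _ ->]]] := fo j; first by rewrite preimage_setT; exact: closedT.
  suff -> : Some @^-1` (Some @` D) = D by [].
  by apply/seteqP; split=> [x [y Dy [<-]]//|x Dx]; exists x.
- move=> e; apply: nC; apply/seteqP; split=> // x _.
  have : (\bigcap_j (Some @^-1` (~` f j))) x by rewrite e.
  by move=> /(_ i I); rewrite /preimage fC /= => -[y Cy [<-]].
- apply/seteqP; split=> [x h|_ [x h <-] j _]; last exact: h.
  have := h i I; rewrite fC => -[y Cy xy].
  by exists y => // j _; rewrite /preimage /= xy; exact: h.
Qed.

(* Irreducibility of [X] makes the family above a topology, hence the proof
   argument. *)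
Definition add_top of irreducible_space X : Type := option X.

HB.instance Definition _ := Choice.on (add_top irrX).
HB.instance Definition _ := isOpenTopological.Build (add_top irrX)
  add_top_openT add_top_openI add_top_open_bigU.

Lemma add_top_closedE (C : set (add_top irrX)) : closed C = add_top_closed C.
Proof.
rewrite -openC; rewrite -[in RHS](setCK C); apply/propext; split; exact: id.
Qed.

End AddTop.

Section Smyth.
Context (X : topologicalType).

Definition compact_saturated : Type :=
  {K : set X | [/\ K !=set0, compact K & saturated K]}.

HB.instance Definition _ := gen_eqMixin compact_saturated.
HB.instance Definition _ := gen_choiceMixin compact_saturated.

Definition smyth_le (K1 K2 : compact_saturated) : bool :=
  `[< sval K2 `<=` sval K1 >].

Lemma smyth_refl : reflexive smyth_le.
Proof. by move=> K; apply/asboolP. Qed.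

Lemma smyth_anti : antisymmetric smyth_le.
Proof.
move=> [K hK] [L hL] /andP[/asboolP/= LK /asboolP/= KL].
have e : K = L by apply/seteqP.
by subst L; congr exist; exact: Prop_irrelevance.
Qed.

Lemma smyth_trans : transitive smyth_le.
Proof.
move=> K1 K2 K3 /asboolP h12 /asboolP h23; apply/asboolP.
exact: subset_trans h23 h12.
Qed.

Fact smyth_display : Order.disp_t. Proof. exact: Order.Disp tt tt. Qed.

HB.instance Definition _ := Order.Le_isPOrder.Build smyth_display
  compact_saturated smyth_refl smyth_anti smyth_trans.

Lemma smyth_leE (K1 K2 : compact_saturated) :
  (K1 <= K2)%O = `[< sval K2 `<=` sval K1 >].
Proof. by []. Qed.

End Smyth.

Definition natpos : Type := {n : nat | 0 < n}.
HB.instance Definition _ := Choice.on natpos.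

(* The element [None] of [option natpos] is the point at infinity. *)
Definition le_infty (k l : option natpos) : bool :=
  match k, l with
  | _, None => true
  | None, Some _ => false
  | Some m, Some n => val m <= val n
  end.

Definition calL : Type := (natpos * natpos * option natpos)%type.
HB.instance Definition _ := Choice.on calL.

Definition calL_le (x y : calL) : bool :=
  let: (i1, j1, k1) := x in
  let: (i2, j2, k2) := y in
  [&& i1 == i2, j1 == j2 & le_infty k1 k2] ||
  [&& val i2 == (val i1).+1, le_infty k1 (Some j2) & k2 == None].

Lemma le_infty_refl : reflexive le_infty.
Proof. by case=> [k|] //=. Qed.

Lemma le_infty_trans : transitive le_infty.
Proof. by case=> [l|] [k|] [m|] //=; exact: leq_trans. Qed.

Lemma le_infty_anti : antisymmetric le_infty.
Proof. by case=> [l|] [k|] //= /anti_leq/val_inj->. Qed.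

Lemma calL_refl : reflexive calL_le.
Proof. by case=> -[i j] k; rewrite /= !eqxx le_infty_refl. Qed.

Lemma calL_anti : antisymmetric calL_le.
Proof.
move=> [[i j] k] [[i' j'] k'] /andP[/= /orP[/and3P[/eqP<- /eqP<- kk']|]].
  case/orP=> [/and3P[_ _ k'k]|/and3P[/eqP]].
    by congr (_, _, _); apply: le_infty_anti; rewrite kk'.
  by move/eqP; rewrite ltn_eqF.
case/and3P=> /eqP ii' _ _ /orP[/and3P[/eqP e _ _]|/and3P[/eqP e _ _]].
  by move/eqP: ii'; rewrite e ltn_eqF.
by move/eqP: ii'; rewrite e ltn_eqF// ltnW.
Qed.

Lemma calL_trans : transitive calL_le.
Proof.
move=> [[i2 j2] k2] [[i1 j1] k1] [[i3 j3] k3] /=.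
case/orP=> [/and3P[/eqP-> /eqP-> k12]|/and3P[i12 k12 /eqP->]].
  case/orP=> [/and3P[/eqP-> /eqP-> k23]|/and3P[i23 k23 k3E]]; apply/orP.
    by left; rewrite !eqxx (le_infty_trans k12).
  by right; apply/and3P; split=> //; exact: le_infty_trans k23.
case/orP=> [/and3P[/eqP<- /eqP<-]|/and3P[_ //]].
by case: k3 => // _; apply/orP; right; apply/and3P.
Qed.

Fact calL_display : Order.disp_t. Proof. exact: Order.Disp tt tt. Qed.

HB.instance Definition _ := Order.Le_isPOrder.Build calL_display
  calL calL_refl calL_anti calL_trans.

Lemma calL_leE (x y : calL) : (x <= y)%O = calL_le x y.
Proof. by []. Qed.

Lemma calL_supremum (i j : natpos) :
  supremums [set x : calL | exists k, x = (i, j, Some k)] ((i, j, None) : calL).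
Proof.
split=> [_ [k ->]|[[i' j'] k'] ub].
  by rewrite /Order.le /= !eqxx.
pose s : natpos := exist _ (val j').+1 (ltn0Sn _).
have := ub _ (ex_intro _ s erefl).
rewrite /Order.le /= => /orP[/and3P[/eqP-> /eqP-> _]|]; last first.
  by rewrite ltnn/= andbF.
rewrite !eqxx /=; case: k' ub => // k ub.
pose t : natpos := exist _ (val k).+1 (ltn0Sn _).
have := ub _ (ex_intro _ t erefl).
by rewrite /Order.le /= ltnn !andbF.
Qed.

Lemma calL_directed (i j : natpos) :
  directed [set x : calL | exists k, x = (i, j, Some k)].
Proof.
split=> [|_ _ [k ->] [l ->]]; first by exists (i, j, Some i), i.
have [kl|/ltnW lk] := leqP (val k) (val l).
  exists (i, j, Some l); split; first by exists l.
    by rewrite /Order.le /= !eqxx kl.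
  by rewrite /Order.le /= !eqxx leqnn.
exists (i, j, Some k); split; first by exists k.
  by rewrite /Order.le /= !eqxx leqnn.
by rewrite /Order.le /= !eqxx lk.
Qed.

(* A nonempty Scott open set contains, at every level beyond some point, all
   the maximal elements whose second coordinate is large enough. *)
Lemma calL_open_tail (U : set calL) : scott_open U -> U !=set0 ->
  exists n : nat, forall i : natpos, n <= val i ->
    exists m : nat, forall j : natpos, m <= val j -> U (i, j, None).
Proof.
move=> [uU sU] [[[i0 j0] k0] U0].
have step (i j : natpos) : U (i, j, None) -> forall i' : natpos,
    val i' = (val i).+1 ->
    exists m : nat, forall j : natpos, m <= val j -> U (i', j, None).
  move=> Uij i' ii'.
  have [_ [[k ->] Uk]] := sU _ _ (calL_directed i j) (calL_supremum i j) Uij.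
  exists (val k) => l kl; apply: uU Uk _.
  by apply/orP; right; apply/and3P; split=> //; apply/eqP.
have {}U0 : U (i0, j0, None).
  by apply: uU U0 _; rewrite /Order.le /= !eqxx; case: k0.
exists (val i0).+1 => -[i i_gt0] /= /subnKC; move: (_ - _) => n.
elim: n i i_gt0 => [|n IH] i i_gt0 e.
  by apply: (step i0 j0 U0); rewrite /= -e addn0.
have [m hm] := IH _ (isT : 0 < (val i0).+1 + n) erefl.
pose l : natpos := exist _ m.+1 (ltn0Sn _).
by apply: (step _ l (hm l (leqnSn m))); rewrite /= -e addnS.
Qed.

Lemma scott_calL_irreducible : irreducible_space (scott calL).
Proof.
pose o : natpos := exist _ 1 isT.
split; [exact: closedT|by exists (o, o, None)|].
move=> [C1 [C2 [cC1 cC2 [_ nC1] [_ nC2] e]]].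
have ne (C : set calL) : ~ (setT `<=` C) -> ~` C !=set0.
  by move=> nC; apply/set0P/eqP => C0; apply: nC; rewrite -(setCK C) C0 setC0.
have [n1 h1] : _ := calL_open_tail (closed_openC cC1) (ne _ nC1).
have [n2 h2] : _ := calL_open_tail (closed_openC cC2) (ne _ nC2).
pose i : natpos := exist _ (n1 + n2).+1 (ltn0Sn _).
have [|m1 {}h1] := h1 i; first by rewrite /= -addnS leq_addr.
have [|m2 {}h2] := h2 i; first by rewrite /= -addSn leq_addl.
pose j : natpos := exist _ (m1 + m2).+1 (ltn0Sn _).
have [] : (C1 `|` C2) (i, j, None) by rewrite -e.
  by apply: h1; rewrite /= -addnS leq_addr.
by apply: h2; rewrite /= -addSn leq_addl.
Qed.

(* Main.v *)
Require Import Defs.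
From mathcomp Require Import all_boot all_order boolp classical_sets.
From mathcomp Require Import filter topology_structure compact.
Set Implicit Arguments.
Unset Strict Implicit.
Unset Printing Implicit Defensive.
Import Order.TTheory.
Local Open Scope classical_set_scope.

(** Call limits the elements (i, j, oo) of L; they are its maximal elements, and
the first coordinate of an element is its level. The only directed suprema in L
that are not attained are those of the columns (i, j, 1) < (i, j, 2) < ..., so a
set is Scott closed when it is a lower set that contains a limit as soon as it
contains the column below it ([calL_closedP]). Above (i, j, k) there are only
the rest of its column and the limits (i+1, l, oo) with k <= l.

Sobriety. Adding a top makes the whole space the closure of the new point and
leaves the other closed sets unchanged, so it suffices that an irreducible
closed C different from L is principal ([sober_add_top]). If some p in C has
above it in C only points of its own column, cutting off the part above p leaves
a closed set, and C is the union of this set and of the ideal generated by the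
last point of C in that column; hence C is this ideal
([irreducible_calL_down]). Assume
that C is not principal. If C had no limit, the last point of C in a column
would be such a p. If C contains a limit of level i, then C contains infinitely
many limits of level i+1, for otherwise a point high enough in the column of
that limit would be such a p. These dominate every finite point of level i, so
C contains the whole level i. Thus all levels lie in C, and C = L
([irreducible_closed_calL]).

Failure of sobriety. Consider the family A of the compact saturated sets other
than the singleton of the top.
- A has no generic point, which would be a compact set contained in every
  principal one, and hence would have an element above all of L
  ([nontop_no_generic_point]).
- A is irreducible. Sending x to its principal filter is a Scott continuous map
  from L, and A is the lower set generated by its image; so A inherits
  irreducibility from L ([principal_continuous], [irreducible_nontop]).
- A is Scott closed. For this one shows that a directed family of members of A
  has a common element x in L ([directed_meet]): the principal filter of x is
  then an upper bound of the family, so the supremum contains x. A compact set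
  meets only finitely many levels ([compact_levels]), and has finitely many
  limits on its lowest level ([compact_lowest_level]). If the family had no
  common element, one could find smaller and smaller members avoiding these
  limits one by one, then level after level, and reach a member that has left
  every level of the initial one. *)

(** * Irreducible closed sets and generic points *)

Lemma irreducible_closedU (X : topologicalType) (A C1 C2 : set X) :
  irreducible_closed A -> closed C1 -> closed C2 -> A `<=` C1 `|` C2 ->
  A `<=` C1 \/ A `<=` C2.
Proof.
move=> [cA _ irrA] cC1 cC2 AC; apply: contrapT => /not_orP[nC1 nC2].
apply: irrA; exists (A `&` C1), (A `&` C2); split; do ?exact: closedI.
- by split=> [x []//|AC1]; apply: nC1 => x /AC1[].
- by split=> [x []//|AC2]; apply: nC2 => x /AC2[].
- rewrite -setIUr; apply/seteqP; split=> [x Ax|x []//].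
  by split=> //; exact: AC.
Qed.

Lemma eq_closure1P (X : topologicalType) (A : set X) (x : X) :
  A = closure [set x] <->
  [/\ closed A, A x & forall B, closed B -> B x -> A `<=` B].
Proof.
rewrite closureE; split=> [->|[cA Ax minA]].
  rewrite -closureE; split; [exact: closed_closure|exact: subset_closure|].
  by move=> B cB Bx; rewrite closureE; apply: smallest_sub => // _ ->.
apply/seteqP; split=> [y Ay B [cB Bx]|]; first exact: (minA B cB (Bx x erefl)).
by apply: smallest_sub => // _ ->.
Qed.

(** * Principal compact saturated sets *)

Section Principal.
Context (X : topologicalType).

(** The up-set of [x] for the specialization order, that is the intersection of
the neighborhoods of [x]. *)
Definition neighborhood_kernel (x : X) : set X :=
  [set y | forall U : set X, open U -> U x -> U y].

Lemma kernel_refl x : neighborhood_kernel x x.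
Proof. by []. Qed.

(** If [y] does not belong to [K] and [K] is an upper set, the complement of the
closure of [y] is an open set that contains [K] but not [y]. *)
Lemma saturatedP (K : set X) :
  saturated K <-> forall x, K x -> neighborhood_kernel x `<=` K.
Proof.
split=> [-> x Kx y xy U [oU KU]|upK]; first by apply: xy => //; exact: Kx.
apply/seteqP; split=> [x Kx U [_]|y Ky]; first exact.
apply: contrapT => nKy.
have : (~` closure [set y]) y.
  apply: Ky; split=> [|x Kx yx].
    by rewrite openC; exact: closed_closure.
  apply/nKy/(upK x Kx) => U oU Ux.
  by have [_ [-> Uy]] := yx U (open_nbhs_nbhs (conj oU Ux)).
by apply; exact: subset_closure.
Qed.

(** An open set that contains [x] already contains the whole kernel. *)
Lemma compact_kernel x : compact (neighborhood_kernel x).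
Proof.
move=> F PF Fx; exists x; split=> // A B FA.
rewrite nbhsE => -[U [oU Ux] UB].
have [y [Ay xy]] := filter_ex (filterI FA Fx).
by exists y; split=> //; apply: UB; exact: (xy U oU Ux).
Qed.

Lemma saturated_kernel x : saturated (neighborhood_kernel x).
Proof. by apply/saturatedP => y xy z yz U oU /(xy U oU) /(yz U oU). Qed.

Definition principal (x : X) : compact_saturated X :=
  exist _ (neighborhood_kernel x)
    (And3 (ex_intro _ x (@kernel_refl x)) (@compact_kernel x)
      (@saturated_kernel x)).

Lemma smyth_leP (K1 K2 : compact_saturated X) :
  reflect (sval K2 `<=` sval K1) (K1 <= K2)%O.
Proof. exact: asboolP. Qed.

Lemma le_principal (K : compact_saturated X) x :
  (K <= principal x)%O <-> sval K x.
Proof.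
split=> [/smyth_leP|Kx]; first exact.
by apply/smyth_leP; have [_ _ /saturatedP] := svalP K; exact.
Qed.

End Principal.

(** * Scott closed sets *)

Section ScottClosed.
Context (d : Order.disp_t) (P : porderType d).

Lemma scott_closedP (C : set (scott P)) :
  closed C <->
  (forall x y : P, (x <= y)%O -> C y -> C x) /\
  (forall (D : set P) s, directed D -> supremums D s -> D `<=` C -> C s).
Proof.
rewrite -openC scott_openE; split=> [[uC sC]|[lC sC]]; split.
- by move=> x y xy Cy; apply: contrapT => nCx; exact: (uC x y).
- move=> D s dD Ds DC; apply: contrapT => nCs.
  by have [x [/DC]] := sC D s dD Ds nCs.
- by move=> x y nCx xy Cy; exact/nCx/(lC _ y).
- move=> D s dD Ds nCs; apply: contrapT => DC; apply: nCs.
  by apply: (sC D) => // x Dx; apply: contrapT => nCx; apply: DC; exists x.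
Qed.

Lemma closed_down (x : P) : closed ([set y | (y <= x)%O] : set (scott P)).
Proof.
apply/scott_closedP; split=> [y z yz /=|D s _ [_ sD] Dx]; first exact: le_trans.
exact: sD.
Qed.

Lemma scott_closure1 (x : P) :
  [set y | (y <= x)%O] = closure ([set x] : set (scott P)).
Proof.
apply/(@eq_closure1P (scott P)); split=> //=; first exact: closed_down.
by move=> B /scott_closedP[lB _] Bx y yx; exact: lB Bx.
Qed.

(** A maximal element of a directed set is its greatest element. *)
Lemma directed_max (D : set P) (s m : P) :
  directed D -> supremums D s -> D m ->
  (forall y, D y -> (m <= y)%O -> y = m) -> s = m.
Proof.
move=> [_ dD] [uD sD] Dm maxm; apply/le_anti/andP; split; last exact: uD.
by apply: sD => x Dx; have [z [Dz xz /(maxm z Dz) <-]] := dD x m Dx Dm.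
Qed.

End ScottClosed.

(** * Adding a top point to an irreducible space *)

Section AddTopTheory.
Context (X : topologicalType) (irrX : irreducible_space X).
Local Notation Xtop := (add_top irrX).

Lemma add_top_closedT (C : set Xtop) : closed C -> C None -> C = setT.
Proof. by rewrite add_top_closedE => -[//|[C0 [_ _ ->]] [x]]. Qed.

Lemma add_top_openN (U : set Xtop) z : open U -> U z -> U None.
Proof.
move=> oU Uz; apply: contrapT => UN.
have : (~` U) z by rewrite (add_top_closedT (open_closedC oU) UN).
exact.
Qed.

Lemma add_top_closed_some (C : set X) :
  closed C -> C <> setT -> closed (Some @` C : set Xtop).
Proof. by move=> cC nC; rewrite add_top_closedE; right; exists C. Qed.

Lemma add_top_closed_preimage (C : set Xtop) :
  closed C -> closed (Some @^-1` C : set X).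
Proof.
rewrite add_top_closedE => -[->|[C0 [cC0 _ ->]]]; first exact: closedT.
rewrite [X in closed X](_ : _ = C0)//.
by apply/seteqP; split=> [x [y Cy [<-]]|x Cx] //; exists x.
Qed.

(** [Some] identifies the closed sets of [X] other than [X] with those of the
extension other than the whole, together with their inclusions; hence with
their irreducibility and generic points. The whole extension is the closure of
the top, and of no other point because [X] itself has no generic point. *)
Lemma sober_add_top :
  (forall x : X, closure [set x] <> setT) ->
  (forall C : set X, irreducible_closed C -> C <> setT ->
     exists! x, C = closure [set x]) ->
  sober Xtop.
Proof.
move=> nogen sob A [cA neA irrA].
have := cA; rewrite add_top_closedE => -[AT|[C [cC nC AC]]].
  exists None; split=> [|[x|//] /eq_closure1P[_ _ minA]].
    rewrite AT; apply/eq_closure1P; split=> // B cB BN.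
    by rewrite (add_top_closedT cB BN).
  have : (Some @` closure [set x]) None.
    apply: (minA (Some @` closure [set x])); last by rewrite AT.
      apply: add_top_closed_some; first exact: closed_closure.
      exact: nogen.
    by exists x => //; exact: subset_closure.
  by case.
have someI (B : set X) x : (Some @` B) (Some x) -> B x by move=> [y By [<-]].
have [] := sob C _ nC.
  split=> //.
    by move: neA; rewrite AC => -[_ [x Cx _]]; exists x.
  move=> [C1 [C2 [cC1 cC2 [sC1 nC1] [sC2 nC2] eC]]]; apply: irrA.
  exists (Some @` C1), (Some @` C2); split.
  - by apply: add_top_closed_some => // CT; apply: nC1; rewrite CT.
  - by apply: add_top_closed_some => // CT; apply: nC2; rewrite CT.
  - rewrite AC; split=> [|h]; first exact: image_subset.
    by apply: nC1 => x Cx; apply: someI; apply: h; exists x.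
  - rewrite AC; split=> [|h]; first exact: image_subset.
    by apply: nC2 => x Cx; apply: someI; apply: h; exists x.
  - by rewrite AC eC image_setU.
move=> x [/eq_closure1P[_ Cx minC] uniqx]; exists (Some x); split.
  apply/eq_closure1P; split=> //; first by rewrite AC; exists x.
  move=> B cB Bx; rewrite AC => _ [y Cy <-].
  exact: (minC (Some @^-1` B) (add_top_closed_preimage cB)).
move=> [y|] /eq_closure1P[_ Ay minA]; last by move: Ay; rewrite AC => -[].
congr Some; apply: uniqx; apply/eq_closure1P; split=> //.
  by apply: someI; rewrite -AC.
move=> B cB By z Cz; have [BT|nB] := pselect (B = setT); first by rewrite BT.
apply: someI; apply: minA; first exact: add_top_closed_some.
  by exists y.
by rewrite AC; exists z.
Qed.

(** Compactness of [K] in the form used below, for a decreasing sequence of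
closed sets with empty intersection in [K]. The hypothesis on [C 0] makes the
images of the [C n] closed, and their complements neighborhoods of the top. *)
Lemma compact_escape (K : set Xtop) (C : nat -> set X) :
  compact K -> (forall n, closed (C n)) ->
  (forall m n, m <= n -> C n `<=` C m) -> C 0 <> setT ->
  (forall x, K (Some x) -> exists n, ~ C n x) ->
  exists n, forall x, K (Some x) -> ~ C n x.
Proof.
move=> cK cC dC C0 KC.
pose F := filter_from [set: nat] (fun n => [set m | n <= m]).
have FF : Filter F.
  apply: filter_from_filter; first by exists 0.
  move=> m n _ _; exists (maxn m n) => // k /=.
  by rewrite geq_max => /andP[].
have nbh z : K z -> exists n, ~ (Some @` C n) z.
  case: z => [x /KC[n nC]|_]; last by exists 0 => -[].
  by exists n => -[y Cy [xy]]; apply: nC; rewrite -xy.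
have cSC n : closed (Some @` C n : set Xtop).
  apply: add_top_closed_some => // CT.
  by apply: C0; apply/seteqP; split=> // x _; apply: (dC 0 n) => //; rewrite CT.
have [] := (compact_near_coveringP K).1 cK nat F
  (fun n z => ~ (Some @` C n) z) FF.
  move=> z /nbh[n nCz].
  exists (~` (Some @` C n), [set m | n <= m]) => /=.
    split; last by exists n.
    apply: open_nbhs_nbhs; split=> //.
    by rewrite openC; exact: cSC.
  move=> [z' m] /= [nz' nm] [x Cx xz']; apply: nz'; exists x => //.
  exact: dC Cx.
move=> n _ /(_ n (leqnn n)) h; exists n => x Kx Cx.
by apply: (h _ Kx); exists x.
Qed.

Lemma compact_saturatedN (K : compact_saturated Xtop) : sval K None.
Proof.
have [[z Kz] _ /saturatedP upK] := svalP K.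
by apply: (upK z Kz) => U oU Uz; exact: add_top_openN Uz.
Qed.

End AddTopTheory.

(** * The power space of a Scott space with a top added *)

Section ScottAddTop.
Context (d : Order.disp_t) (P : porderType d).
Context (irrP : irreducible_space (scott P)).
Local Notation Ptop := (add_top irrP).
Local Notation KP := (compact_saturated Ptop).
Local Notation up x := (principal (Some x : Ptop)).

(** The specialization order of a Scott space, and also of its extension, is the
given order: lower sets generated by a point are closed. *)
Lemma kernel_some (x y : P) :
  neighborhood_kernel (Some x : Ptop) (Some y) <-> (x <= y)%O.
Proof.
split=> [xy|xy U oU Ux].
  (* The image of the ideal of y is closed only when this ideal is proper. *)
  have [yT|nyT] := pselect ([set z | (z <= y)%O] = setT :> set (scott P)).
    by have : [set z | (z <= y)%O] x by rewrite yT.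
  apply: contrapT => nxy.
  have /(_ (~` (Some @` [set z | (z <= y)%O]))) := xy.
  case=> [|[z zy [zx]]|]; last by exists y => /=.
    by rewrite openC; apply: add_top_closed_some => //; exact: closed_down.
  by apply: nxy; rewrite -zx.
apply: contrapT => nUy.
have /scott_closedP[lU _] := add_top_closed_preimage (open_closedC oU).
exact: (lU x y xy nUy Ux).
Qed.

Lemma compact_saturated_upper (K : KP) (x y : P) :
  (x <= y)%O -> sval K (Some x) -> sval K (Some y).
Proof.
move=> xy Kx; have [_ _ /saturatedP upK] := svalP K.
by apply: (upK _ Kx); apply/kernel_some.
Qed.

(** The map from points to principal filters preserves directed suprema: a
compact saturated set contained in the principal filters of all elements of [D]
consists, apart from the top, of upper bounds of [D]. *)
Lemma principal_continuous (C : set (scott KP)) :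
  closed C ->
  closed ((fun x : P => up x) @^-1` C : set (scott P)).
Proof.
move=> /scott_closedP[lC sC].
apply/scott_closedP; split=> [x y xy|D s dD Ds DC].
  by apply: lC; apply/le_principal/kernel_some.
apply: (sC [set up x | x in D] (up s)); last by move=> _ [x /DC ? <-].
  split=> [|_ _ [x Dx <-] [y Dy <-]].
    by have [[x Dx] _] := dD; exists (up x), x.
  have [z [Dz xz yz]] := dD.2 x y Dx Dy.
  by exists (up z); split; first (by exists z);
    apply/le_principal/kernel_some.
split=> [_ [x Dx <-]|K ubK].
  by apply/le_principal/kernel_some; exact: Ds.1.
apply/smyth_leP => -[y|_]; last exact: (compact_saturatedN (principal _)).
move=> Ky; apply/kernel_some/Ds.2 => x Dx.
have /smyth_leP/(_ _ Ky) := ubK _ (ex_intro2 _ _ x Dx erefl).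
by move=> /kernel_some.
Qed.

(** The condition on directed families says that the nontrivial compact sets form
a Scott closed family: the principal filter of a common point bounds the family.
Irreducibility is carried over from [P] by the continuous map
[principal_continuous], since every nontrivial [K] contains a principal filter,
that is, lies below its image of a point. *)
Lemma irreducible_nontop :
  (forall D : set KP, directed D ->
     (forall K, D K -> exists x, sval K (Some x)) ->
     exists x, forall K, D K -> sval K (Some x)) ->
  irreducible_closed ([set K | exists x, sval K (Some x)] : set (scott KP)).
Proof.
move=> meetD; split.
- apply/scott_closedP; split=> [K L /smyth_leP KL [x Lx]|D S dD [_ DS] DA].
    by exists x; exact: KL.
  have [x Dx] := meetD D dD DA; exists x; apply/(@le_principal Ptop).
  by apply: DS => K /Dx Kx; apply/le_principal.
- have [_ [x _] _] := irrP.
  by exists (up x), x; exact: kernel_refl.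
- move=> [C1 [C2 [cC1 cC2 [_ nC1] [_ nC2] eC]]].
  have full (C : set (scott KP)) : closed C ->
      [set: scott P] `<=` (fun x : P => up x) @^-1` C ->
      [set K : scott KP | exists x, sval K (Some x)] `<=` C.
    move=> /scott_closedP[lC _] CT K [x /le_principal Kx].
    exact: lC Kx (CT x I).
  have [x _||] := irreducible_closedU irrP (principal_continuous cC1)
    (principal_continuous cC2).
  + rewrite -preimage_setU -eC.
    by exists x; exact: kernel_refl.
  + by move=> /(full _ cC1).
  + by move=> /(full _ cC2).
Qed.

Lemma nontop_no_generic_point (K : scott KP) :
  (forall x : P, exists y : P, ~ (y <= x)%O) ->
  [set L : scott KP | exists x, sval L (Some x)] <> closure [set K].
Proof.
move=> nmax eK; have : closure [set K] K by exact: subset_closure.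
rewrite -eK => -[x Kx].
have [y nyx] := nmax x; apply: nyx.
have : closure [set K] (up y).
  by rewrite -eK; exists y; exact: kernel_refl.
by rewrite -scott_closure1 => /smyth_leP/(_ _ Kx) /kernel_some.
Qed.

End ScottAddTop.

(** * Order and Scott closed sets of L *)

Section calLTheory.

Definition pos (n : nat) : natpos := exist _ n.+1 (ltn0Sn n).

Lemma posE (i : natpos) : i = pos (val i).-1.
Proof. by case: i => -[//|n] n_gt0; exact: val_inj. Qed.

Lemma calL_leP (i j i' j' : natpos) (k k' : option natpos) :
  ((i, j, k) <= (i', j', k') :> calL)%O <->
  [/\ i' = i, j' = j & le_infty k k'] \/
  [/\ val i' = (val i).+1, le_infty k (Some j') & k' = None].
Proof.
rewrite calL_leE /=; split.
  by case/orP=> /and3P[/eqP-> h]; [move/eqP: h => ->; left|move/eqP; right].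
by case=> -[-> hj hk]; rewrite !(hj, hk) !eqxx ?orbT.
Qed.

Lemma calL_limit_max (i j : natpos) (y : calL) :
  ((i, j, None) <= y :> calL)%O -> y = (i, j, None).
Proof.
case: y => -[i' j'] k' /calL_leP[[-> ->]|[_ //]].
by case: k'.
Qed.

Lemma calL_le_limit (i j : natpos) (k : option natpos) :
  ((i, j, k) <= (i, j, None) :> calL)%O.
Proof. by apply/calL_leP; left; split=> //; case: k. Qed.

Lemma calL_le_next (n : nat) (j k l : natpos) : val k <= val l ->
  ((pos n, j, Some k) <= (pos n.+1, l, None) :> calL)%O.
Proof. by move=> kl; apply/calL_leP; right. Qed.

Lemma calL_down_proper (x : calL) : exists y : calL, ~ (y <= x)%O.
Proof.
case: x => -[i j] k; exists (pos (val i).+1, j, None).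
move/calL_leP => [[e _ _]|[e _ _]].
  by have := congr1 val e; rewrite /= => /eqP; rewrite ltn_eqF// ltnW.
by move/eqP: e; rewrite /= ltn_eqF// !ltnS leqW// leqW.
Qed.

(** A directed set that misses its supremum has no maximal element, hence
contains no limit; two comparable elements that are not limits lie in the same
column, so the set climbs through a single column. *)
Lemma calL_directed_sup (D : set calL) (s : calL) :
  directed D -> supremums D s ->
  D s \/ exists i j, s = (i, j, None) /\
    forall n, exists2 k, n <= val k & D (i, j, Some k).
Proof.
move=> dD Ds; have [|nDs] := pselect (D s); [by left|right].
have nomax x : D x -> exists y, [/\ D y, (x <= y)%O & y <> x].
  move=> Dx; apply: contrapT => nmax; apply: nDs.
  rewrite (directed_max dD Ds Dx)// => y Dy xy.
  by apply: contrapT => yx; apply: nmax; exists y.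
have nolim i j : ~ D (i, j, None).
  by move=> /nomax[y [_ /calL_limit_max ->]].
have [[[[i j] [k0|]] D0] _] := dD; last by have := nolim _ _ D0.
have unb n : exists2 k, n <= val k & D (i, j, Some k).
  elim: n => [|n [k nk /nomax[[[i' j'] k'] [Dk' kk' ne]]]]; first by exists k0.
  case: k' => [l|] in Dk' kk' ne *; last by have := nolim _ _ Dk'.
  case/calL_leP: kk' ne Dk' => [[-> -> /= kl] ne Dl|[_ _ //]]; exists l => //.
  apply: leq_ltn_trans nk _; rewrite ltn_neqAle kl andbT; apply/eqP => e.
  by apply: ne; congr (_, _, Some _); exact/esym/val_inj.
exists i, j; split=> //.
(* A bound of an unbounded part of a column lies in this column, as one on the
   next level would bound the third coordinates by its second coordinate. *)
case: s Ds nDs => -[i' j'] k' [ub _] _.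
have [l jl /ub/calL_leP[[-> -> _]|[_ /=]]] := unb (val j').+1; last first.
  by rewrite leqNgt jl.
case: k' ub => // k' ub.
have [m km /ub/calL_leP[[_ _ /=]|[]//]] := unb (val k').+1.
by rewrite leqNgt km.
Qed.

Lemma calL_closedP (C : set (scott calL)) :
  closed C <->
  (forall x y : calL, (x <= y)%O -> C y -> C x) /\
  (forall i j, (forall k, C (i, j, Some k)) -> C (i, j, None)).
Proof.
split=> [/scott_closedP[lC sC]|[lC sC]]; first split=> // i j Cij.
  by apply: sC (calL_directed i j) (calL_supremum i j) _ => _ [k ->].
apply/scott_closedP; split=> // D s dD Ds DC.
have [/DC//|[i [j [-> unb]]]] := calL_directed_sup dD Ds.
apply: sC => k; have [l kl /DC] := unb (val k).
by apply: lC; apply/calL_leP; left.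
Qed.

(** * Proper irreducible closed sets of L are principal *)

(** Removing from [C] the points above [(i, j, k)] leaves a closed set: these
points all lie in the column [(i, j)], so a limit among them is the supremum of
a column part of which has been removed too. By irreducibility the removed
part, bounded by [m], is all that matters. *)
Lemma irreducible_calL_down (C : set (scott calL)) (i j k : natpos) (m : calL) :
  irreducible_closed C -> C (i, j, Some k) -> C m ->
  (forall x : calL, C x -> ((i, j, Some k) <= x :> calL)%O ->
     x.1 = (i, j) /\ (x <= m)%O) ->
  C = [set x | (x <= m)%O].
Proof.
move=> irrC Cp Cm Cup.
have [/calL_closedP[lC sC] _ _] := irrC.
have cl : closed (C `\` [set x | ((i, j, Some k) <= x :> calL)%O] :
    set (scott calL)).
  apply/calL_closedP; split=> [x y xy [Cy npy]|i' j' h].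
    by split; [exact: lC Cy|move=> px; apply: npy; exact: le_trans px xy].
  have Clim : C (i', j', None) by apply: sC => l; have [] := h l.
  split=> // /(Cup _ Clim)[[ei ej] _]; have [_ +] := h k; rewrite ei ej; apply.
  exact: lexx.
have [x Cx|sub|sub] := irreducible_closedU irrC cl (@closed_down _ calL m).
- have [px|npx] := pselect ((i, j, Some k) <= x :> calL)%O; last by left.
  by right; have [] := Cup x Cx px.
- by have [_] := sub _ Cp; case; exact: lexx.
- by apply/seteqP; split=> // x xm; exact: lC xm Cm.
Qed.

Lemma irreducible_closed_calL (C : set (scott calL)) :
  irreducible_closed C -> C <> setT ->
  exists x : calL, C = [set y | (y <= x)%O].
Proof.
move=> irrC nC; apply: contrapT => ndown.
have [/calL_closedP[lC sC] [[[i j] k] Cijk] _] := irrC.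
have [[n [l Cnl]]|nolim] := pselect (exists n j, C (pos n, j, None)); last first.
  have {}nolim i' j' : ~ C (i', j', None).
    by move=> Clim; apply: nolim; exists (val i').-1, j'; rewrite -posE.
  (* Without limits, the last point of C in a column would generate C; so the
     column through the given point of C never leaves C. *)
  apply: (nolim i j); apply: sC => m.
  have [p mp] : exists2 p, val m <= val p & C (i, j, Some p).
    elim: (val m) => [|q [p qp Cp]].
      by case: k Cijk => [p ?|/nolim//]; exists p.
    apply: contrapT => max; apply: ndown; exists (i, j, Some p).
    apply: (irreducible_calL_down irrC Cp Cp) => -[[i' j'] [r|]] Cr; last first.
      by have := nolim _ _ Cr.
    case/calL_leP=> [[ei ej /= pr]|[]//]; rewrite ei ej in Cr *; split=> //.
    apply/calL_leP; left; split=> //=; rewrite leqNgt; apply/negP => pr'.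
    by apply: max; exists r => //; exact: leq_ltn_trans qp pr'.
  by apply: lC; apply/calL_leP; left.
(* If no limit of C on the next level had a second coordinate at least q, then in
   the column of a limit of C on the level of pos m, the point of height q+1
   would have no element of C above it outside that column. *)
have next m : (exists j, C (pos m, j, None)) ->
    forall k, exists2 j', k <= val j' & C (pos m.+1, j', None).
  move=> [j' Cj'] q; apply: contrapT => bounded; apply: ndown.
  have Cq : C (pos m, j', Some (pos q)).
    by apply: lC Cj'; exact: calL_le_limit.
  exists (pos m, j', None).
  apply: (irreducible_calL_down irrC Cq Cj') => -[[i1 j1] k1] C1.
  case/calL_leP=> [[-> -> _]|[e qj k1N]].
    by split=> //; exact: calL_le_limit.
  case: bounded; exists j1; first exact: ltnW.
  by rewrite k1N (posE i1) e in C1.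
have full m : (exists j, C (pos m, j, None)) -> forall j, C (pos m, j, None).
  move=> /next nextm j'; apply: sC => q; have [r qr] := nextm (val q).
  by apply: lC; exact: calL_le_next.
have step m : (exists j, C (pos m, j, None)) <->
    (exists j, C (pos m.+1, j, None)).
  split=> [/next/(_ 0)[j' _ Cj']|/full Cm]; first by exists j'.
  by exists j; apply: sC => q; apply: lC (Cm q); exact: calL_le_next.
have to0 m : (exists j, C (pos m, j, None)) <-> (exists j, C (pos 0, j, None)).
  by elim: m => // m IH; rewrite -step.
apply: nC; apply/seteqP; split=> // -[[i' j'] k'] _.
apply: lC (calL_le_limit i' j' k') _; rewrite (posE i').
by apply: full; apply/to0/(to0 n); exists l.
Qed.

(** * Compact saturated sets of L with a top added *)

Local Notation Ltop := (add_top scott_calL_irreducible).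

(** Choose a limit [(i, g i, oo)] of [K] on every level that [K] meets. The lower
sets generated by the chosen limits of level at least [n] decrease to the empty
set, because an element is below limits of its own level and of the next one
only; so compactness stops the choice. They are closed: a column contained in
one of them does not lie below the single chosen limit of the next level, so it
is the column of a chosen limit. *)
Lemma compact_levels (K : compact_saturated Ltop) :
  exists N, forall x : calL, sval K (Some x) -> val x.1.1 <= N.
Proof.
have /choice[g gK] : forall i : natpos, exists j' : natpos, forall j : natpos,
    sval K (Some (i, j, None)) -> sval K (Some (i, j', None)).
  move=> i; have [[j Kj]|nK] := pselect (exists j, sval K (Some (i, j, None))).
    by exists j.
  by exists i => j Kj; case: nK; exists j.
pose C n : set (scott calL) :=
  [set x | exists2 i, n <= val i & (x <= (i, g i, None) :> calL)%O].
have [_ cK _] := svalP K.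
have CT x n : (val x.1.1).+2 <= n -> ~ C n x.
  case: x => -[i j] k /= n_ge [i' ni'] /calL_leP.
  have := leq_trans n_ge ni'.
  by case=> h [[e _ _]|[e _ _]]; move: h; rewrite e ltnNge ?ltnS ?leqnn ?leqnSn.
have [n|m n mn x [i ni xi]|C0|x _|n nK] := compact_escape (C := C) cK.
- apply/calL_closedP; split=> [x y xy [i ni yi]|i j Cij].
    by exists i => //; exact: le_trans xy yi.
  have [i' ni' /calL_leP[[ei ej _]|[e /= h _]]] :=
    Cij (pos (val (g (pos (val i))))).
    by exists i' => //; rewrite ei in ej *; rewrite ej; exact: lexx.
  by move: h; rewrite (posE i') e /= ltnn.
- by exists i => //; exact: leq_trans ni.
(* The limit just after the chosen one on the first level is not in C 0. *)
- have : C 0 (pos 0, pos (val (g (pos 0))), None) by rewrite C0.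
  case=> i _ /calL_limit_max[-> /(congr1 val)/=/eqP].
  by rewrite ltn_eqF.
- by exists (val x.1.1).+2; exact: CT.
exists n => -[[i j] k] Kx; rewrite leqNgt; apply/negP => /= ni.
have Kg : sval K (Some (i, g i, None)).
  by apply: (gK i j); exact: compact_saturated_upper (calL_le_limit i j k) Kx.
apply: (nK _ Kg); exists i; [exact: ltnW|exact: lexx].
Qed.

(** The levels below [i] together with the columns of level [i] from the [n]-th
on form a closed set: each column is inside or outside, limit included, and an
element of another column below one of level [i] has level [i-1]. These sets
decrease to the levels below [i], which [K] does not meet. *)
Lemma compact_lowest_level (K : compact_saturated Ltop) (i : nat) :
  (forall x : calL, sval K (Some x) -> i <= val x.1.1) ->
  exists n, forall x : calL, sval K (Some x) -> val x.1.1 = i -> val x.1.2 < n.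
Proof.
move=> Ki.
pose C n : set (scott calL) :=
  [set x : calL | val x.1.1 < i \/ val x.1.1 = i /\ n <= val x.1.2].
have [_ cK _] := svalP K.
have [n|m n mn x|C0|x Kx|n nK] := compact_escape (C := C) cK.
- apply/calL_closedP; split=> [[[i1 j1] k1] [[i2 j2] k2]|i' j' /(_ i')]//.
  rewrite /C/=; case/calL_leP=> [[-> -> _]//|[/= e _ _]].
  by case=> [h|[h _]]; left; [apply: ltnW; rewrite -e|rewrite -h e].
- by case=> [h|[h nx]]; [left|right; split=> //; exact: leq_trans nx].
- have : C 0 (pos i, pos i, None) by rewrite C0.
  by case=> /= [|[/eqP]]; [rewrite ltnNge leqnSn|rewrite gtn_eqF].
- exists (val x.1.2).+1 => -[|[_]]; last by rewrite ltnn.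
  by rewrite ltnNge Ki.
exists n => x Kx xi; rewrite ltnNge; apply/negP => nx.
by apply: (nK x Kx); right.
Qed.

(** Otherwise every point can be avoided by passing to a smaller member of the
family. Since the lowest level of a member carries finitely many of its limits,
a still smaller member leaves this level; repeating this contradicts the bound
on the levels of the initial member. *)
Lemma directed_meet (D : set (compact_saturated Ltop)) :
  directed D -> (forall K, D K -> exists x, sval K (Some x)) ->
  exists x, forall K, D K -> sval K (Some x).
Proof.
move=> [[K0 D0] dD] Dne; apply: contrapT => nomeet.
have avoid K x : D K -> exists L, [/\ D L, (K <= L)%O & ~ sval L (Some x)].
  move=> DK; have [M DM nM] : exists2 M, D M & ~ sval M (Some x).
    apply: contrapT => all; apply: nomeet; exists x => M DM.
    by apply: contrapT => nM; apply: all; exists M.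
  have [L [DL KL /smyth_leP ML]] := dD K M DK DM.
  by exists L; split=> // /ML.
have climb i : exists K, [/\ D K, (K0 <= K)%O &
    forall x : calL, sval K (Some x) -> i < val x.1.1].
  elim: i => [|i [K [DK K0K Ki]]].
    by exists K0; split=> // x _; exact: valP x.1.1.
  have [n Kn] := compact_lowest_level Ki.
  have [L [DL KL Ln]] : exists L, [/\ D L, (K <= L)%O &
      forall j, val j <= n -> ~ sval L (Some (pos i, j, None))].
    elim: n {Kn} => [|n [L [DL KL Ln]]].
      by exists K; split=> // -[[|j] j_gt0].
    have [M [DM LM nM]] := avoid L (pos i, pos n, None) DL.
    exists M; split=> //; first exact: le_trans KL LM.
    move=> j; rewrite leq_eqVlt => /orP[/eqP jn|jn Mj].
      by rewrite (posE j) jn.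
    by apply: (Ln j jn); move/smyth_leP: LM; exact.
  exists L; split=> //; first exact: le_trans K0K KL.
  move=> [[i' j] k] Lx /=.
  have Kx : sval K (Some (i', j, k)) by move/smyth_leP: KL; exact.
  rewrite ltn_neqAle (Ki _ Kx) andbT; apply/eqP => ei.
  apply: (Ln j (ltnW (Kn _ Kx (esym ei)))).
  rewrite [pos i](_ : _ = i'); last exact: val_inj.
  exact: compact_saturated_upper (calL_le_limit i' j k) Lx.
have [N K0N] := compact_levels K0.
have [K [DK /smyth_leP K0K KN]] := climb N.
have [x Kx] := Dne K DK.
by have := KN x Kx; rewrite ltnNge K0N//; exact: K0K.
Qed.

End calLTheory.

Theorem theorem7p17 :
  sober (add_top scott_calL_irreducible) /\
  ~ sober (scott (compact_saturated (add_top scott_calL_irreducible))).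
Proof.
split.
  apply: sober_add_top => [x|C irrC nC].
    rewrite -scott_closure1 => xT; have [y] := calL_down_proper x; apply.
    by have : setT y by []; rewrite -xT.
  have [x Cx] := irreducible_closed_calL irrC nC.
  exists x; split=> [|y]; first by rewrite Cx scott_closure1.
  rewrite Cx -scott_closure1 => xy; apply/le_anti/andP; split.
    by move: xy => /seteqP[+ _]; apply; exact: lexx.
  by move: xy => /seteqP[_]; apply; exact: lexx.
move=> /(_ _ (irreducible_nontop directed_meet))[K [eK _]].
exact: nontop_no_generic_point calL_down_proper eK.
Qed.
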